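(* Let $\Omega$ be a finite nonempty set with an algebra $\mathcal{F}$ of subsets, let $E\in\mathcal{F}$ be the evidence collected by the agent, and assume that $\underline{P}$ is a belief function on $\mathcal{F}$ having mass function $m$ and such that $\underline{P}(E)>0$. Let $\mathfrak{f}:\mathcal{F}\times\mathcal{F}\to[0,1]$ satisfy (a) $\sum_{B\in\mathcal{F}}\mathfrak{f}(B,X)=1$ for all $X\in\mathcal{F}$; (b) $\mathfrak{f}(B,X)=0$ for all $X\in\mathcal{F}$ whenever $B\subseteq E^c$; (c) $\mathfrak{f}(\emptyset,X)=0$ for all $X\in\mathcal{F}$. Let $\underline{P}^I(\cdot\mid E)$, with conjugate $\overline{P}^I(\cdot\mid E)$, be obtained from $\underline{P}$ by Gärdenfors' generalized imaging updating rule with function $\mathfrak{f}$. Then for any $A\in\mathcal{F}$, Gärdenfors' generalized imaging on $E$ strictly constricts $A$ (i.e. $\underline{P}^I(A\mid E)>\underline{P}(A)$ and $\overline{P}^I(A\mid E)<\overline{P}(A)$) if and only if $$\sum_{B\subseteq A}\Big[\sum_{X\in\mathcal{F}}\mathfrak{f}(B,X)m(X)-m(B)\Big]>0\quad\text{and}\quad\sum_{B\subseteq A^c}\Big[\sum_{X\in\mathcal{F}}\mathfrak{f}(B,X)m(X)-m(B)\Big]>0,$$ where the sums over $B$ range over the elements $B$ of $\mathcal{F}$ contained in $A$ and in $A^c$, respectively.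
   Context: A belief function is a set function $\underline{P}:\mathcal{F}\to[0,1]$ with $\underline{P}(\emptyset)=0$, $\underline{P}(\Omega)=1$, monotone under inclusion, and such that for every $k$ and all $A,A_1,\dots,A_k\in\mathcal{F}$ with $A_i\subseteq A$, $\underline{P}(A)\ge\sum_{\emptyset\ne\mathcal{I}\subseteq\{1,\dots,k\}}(-1)^{\#\mathcal{I}-1}\underline{P}(\cap_{i\in\mathcal{I}}A_i)$. Its conjugate upper probability is $\overline{P}(A)=1-\underline{P}(A^c)$. Its mass function is the non-negative function $m:\mathcal{F}\to[0,1]$, $m(A)=\sum_{B\subseteq A}(-1)^{\#(A\setminus B)}\underline{P}(B)$ (sum over $B\in\mathcal{F}$); it satisfies $m(\emptyset)=0$, $\sum_{B\subseteq\Omega}m(B)=1$ and $\underline{P}(A)=\sum_{B\subseteq A}m(B)$, and is unique to $\underline{P}$. Gärdenfors' generalized imaging updating rule: $\underline{P}^I(\cdot\mid E)$ is the belief function whose mass function is $m^I(A\mid E)=\sum_{X\in\mathcal{F}}\mathfrak{f}(A,X)m(X)$ for all $A\in\mathcal{F}$; thus $\underline{P}^I(A\mid E)=\sum_{B\subseteq A}m^I(B\mid E)$ and $\overline{P}^I(A\mid E)=1-\underline{P}^I(A^c\mid E)$.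
   Formalization: In the formula for the mass function, the exponent #(A\B) counts the atoms of the algebra contained in A\B instead of points; with points, P(A)=sum of m(B) over B⊆A can fail when atoms have several points. The two agree on the full powerset. *)

(* Defs.v *)
From mathcomp Require Import all_boot all_order all_algebra.

Set Implicit Arguments.
Unset Strict Implicit.
Unset Printing Implicit Defensive.

Import Order.TTheory GRing.Theory Num.Theory.
Local Open Scope ring_scope.

(* An algebra of subsets of Omega is a set of sets [F]. A function on an
   algebra is represented by a function on all of [{set Omega}], of which only
   the values at members of [F] are ever constrained or used. *)

Record set_algebra (Omega : finType) (F : {set {set Omega}}) : Prop :=
  SetAlgebra {
    algebra_setT : [set: Omega] \in F;
    algebra_setC : forall A, A \in F -> ~: A \in F;
    algebra_setU : forall A B, A \in F -> B \in F -> A :|: B \in F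
  }.

Record belief_function (R : realFieldType) (Omega : finType)
    (F : {set {set Omega}}) (P : {set Omega} -> R) : Prop :=
  BeliefFunction {
    belief_range : forall A, A \in F -> 0 <= P A <= 1;
    belief_set0 : P set0 = 0;
    belief_setT : P [set: Omega] = 1;
    belief_mono : forall A B, A \in F -> B \in F -> A \subset B -> P A <= P B;
    belief_totally_mono : forall (k : nat) (A : {set Omega})
        (A_ : 'I_k -> {set Omega}),
      A \in F -> (forall i, A_ i \in F) -> (forall i, A_ i \subset A) ->
      P A >= \sum_(I : {set 'I_k} | I != set0)
               (-1) ^+ (#|I| - 1) * P (\bigcap_(i in I) A_ i)
  }.

Definition upper (R : realFieldType) (Omega : finType)
    (P : {set Omega} -> R) (A : {set Omega}) : R := 1 - P (~: A).

Definition atoms (Omega : finType) (F : {set {set Omega}}) :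
    {set {set Omega}} :=
  [set a | minset [pred B : {set Omega} | (B \in F) && (B != set0)] a].

Definition natoms (Omega : finType) (F : {set {set Omega}})
    (A : {set Omega}) : nat := #|[set a in atoms F | a \subset A]|.

(* The Moebius inverse of [P] along inclusion in [F]. The exponent #(A \ B)
   counts the atoms of [F] contained in A \ B. It is the cardinality of A \ B
   when [F] is the full powerset; on a coarser algebra, where atoms may have
   several points, counting points would not give the inverse of
   P(A) = sum_(B in F, B \subset A) m(B). *)
Definition mass (R : realFieldType) (Omega : finType) (F : {set {set Omega}})
    (P : {set Omega} -> R) (A : {set Omega}) : R :=
  \sum_(B in F | B \subset A) (-1) ^+ natoms F (A :\: B) * P B.

Definition mass_function (R : realFieldType) (Omega : finType)
    (F : {set {set Omega}}) (P m : {set Omega} -> R) : Prop :=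
  forall A, A \in F -> m A = mass F P A.

Record imaging_weights (R : realFieldType) (Omega : finType)
    (F : {set {set Omega}}) (E : {set Omega})
    (f : {set Omega} -> {set Omega} -> R) : Prop :=
  ImagingWeights {
    weights_range : forall B X, B \in F -> X \in F -> 0 <= f B X <= 1;
    weights_sum : forall X, X \in F -> \sum_(B in F) f B X = 1;
    weights_setC : forall B X, B \in F -> X \in F ->
      B \subset ~: E -> f B X = 0;
    weights_set0 : forall X, X \in F -> f set0 X = 0
  }.

Definition imaging_mass (R : realFieldType) (Omega : finType)
    (F : {set {set Omega}}) (f : {set Omega} -> {set Omega} -> R)
    (m : {set Omega} -> R) (A : {set Omega}) : R :=
  \sum_(X in F) f A X * m X.

(* The evidence E enters only through the constraints on [f]. *)
Definition generalized_imaging (R : realFieldType) (Omega : finType)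
    (F : {set {set Omega}}) (f : {set Omega} -> {set Omega} -> R)
    (m PI : {set Omega} -> R) : Prop :=
  belief_function F PI /\ mass_function F PI (imaging_mass F f m).

Definition strictly_constricts (R : realFieldType) (Omega : finType)
    (P Q : {set Omega} -> R) (A : {set Omega}) : Prop :=
  Q A > P A /\ upper Q A < upper P A.

(* Main.v *)
Require Import Defs.
From mathcomp Require Import all_boot all_order all_algebra.

Set Implicit Arguments.
Unset Strict Implicit.
Unset Printing Implicit Defensive.

Import Order.TTheory GRing.Theory Num.Theory.
Local Open Scope ring_scope.

(* By Moebius inversion on the finite Boolean algebra F, the two sums are
   PI(A) - P(A) and PI(A^c) - P(A^c); conjugacy turns the positivity of the
   second into upper PI A < upper P A. The inversion comes from the involution
   that toggles an atom of A \ C in the sets between C and A. *)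

Section SetAlgebra.
Variables (Omega : finType) (F : {set {set Omega}}).
Hypothesis algF : set_algebra F.
Implicit Types A B C X a b : {set Omega}.

Lemma algebra_setI A B : A \in F -> B \in F -> A :&: B \in F.
Proof.
move=> AF BF; rewrite -[A :&: B]setCK setCI.
by apply: (algebra_setC algF); apply: (algebra_setU algF);
  apply: (algebra_setC algF).
Qed.

Lemma algebra_setD A B : A \in F -> B \in F -> A :\: B \in F.
Proof.
by move=> AF BF; rewrite setDE; apply: algebra_setI => //; apply: algebra_setC.
Qed.

Lemma atom_algebra a : a \in atoms F -> a \in F.
Proof. by rewrite inE => /minsetp /andP[]. Qed.

Lemma atom_neq0 a : a \in atoms F -> a != set0.
Proof. by rewrite inE => /minsetp /andP[]. Qed.

(** The trace [a :&: B] is a member of [F] inside [a], so minimality leaves only two cases: it is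
    empty or it is all of [a]. *)
Lemma atom_nsub_disjoint a B : a \in atoms F -> B \in F ->
  ~~ (a \subset B) = [disjoint a & B].
Proof.
move=> aF BF; rewrite -setI_eq0.
have [aB0|aBN0] := eqVneq (a :&: B) set0.
  apply: contra (atom_neq0 aF) => aB.
  by rewrite -aB0 (setIidPl aB).
apply/negbF; apply/setIidPl.
have := aF; rewrite inE => /minsetP[_]; apply; last exact: subsetIl.
by rewrite inE aBN0 algebra_setI // atom_algebra.
Qed.

Lemma exists_atom A : A \in F -> A != set0 ->
  exists2 a, a \in atoms F & a \subset A.
Proof.
move=> AF AN0.
have [|a aP aA] := @minset_exists _ [pred B | (B \in F) && (B != set0)] A.
  by rewrite inE AF.
by exists a; rewrite ?inE.
Qed.

Lemma natoms_set0 : natoms F set0 = 0%N.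
Proof.
apply/eqP; rewrite cards_eq0; apply/eqP/setP=> a; rewrite !inE subset0.
by apply/andP=> -[aF]; apply/negP/atom_neq0; rewrite inE.
Qed.

(** Distinct atoms are disjoint, so an atom below [X :|: a] other than [a] already lies in [X]. This
    makes the sign flip when [a] is added. *)
Lemma natomsU1 a X : a \in atoms F -> [disjoint a & X] ->
  natoms F (X :|: a) = (natoms F X).+1.
Proof.
move=> aF aX; rewrite /natoms.
have -> : [set b in atoms F | b \subset X :|: a] =
          a |: [set b in atoms F | b \subset X].
  apply/setP=> b; rewrite in_setU1 !in_set -[minset _ b]in_set.
  have [->|ba] /= := eqVneq b a; first by rewrite aF subsetUr.
  have [bF|//] /= := boolP (b \in atoms F).
  suff ba0 : [disjoint b & a].
    apply/idP/idP => [bXa|bX]; last exact: subset_trans bX (subsetUl _ _).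
    by rewrite -(setIidPl bXa) setIUr (disjoint_setI0 ba0) setU0 subsetIr.
  rewrite -(atom_nsub_disjoint bF (atom_algebra aF)).
  apply: contra ba => bsa; apply/eqP.
  have := aF; rewrite inE => /minsetP[_]; apply=> //.
  by rewrite inE atom_algebra // atom_neq0.
rewrite cardsU1 [a \in [set _ | _]]inE.
suff /negbTE-> : ~~ (a \subset X) by rewrite andbF add1n.
apply: contra (atom_neq0 aF) => /setIidPl <-.
by rewrite setI_eq0.
Qed.

Variable R : realFieldType.

Lemma alternating_sum_interval A C : A \in F -> C \in F -> C \subset A ->
  \sum_(B in F | (C \subset B) && (B \subset A)) (-1) ^+ natoms F (B :\: C)
    = (C == A)%:R :> R.
Proof.
move=> AF CF CA; have [->|CneA] := eqVneq C A.
  rewrite (big_pred1 A) => [|B]; first by rewrite setDv natoms_set0.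
  rewrite /= -eqEsubset [A == B]eq_sym andbC.
  by case: eqP => // ->; rewrite AF.
have [||a aF aAC] := @exists_atom (A :\: C).
- exact: algebra_setD.
- apply: contra CneA; rewrite setD_eq0 => AC.
  by rewrite eqEsubset CA.
have [aA aC] : a \subset A /\ [disjoint a & C].
  by move: aAC; rewrite subsetD => /andP[].
(* The terms are split by whether [B] contains [a]. Those that do are then written as [B :|: a],
   where the condition [(B :|: a) :\: a == B] records that [B] is disjoint from [a]. *)
rewrite (bigID (fun B => a \subset B)) /=.
rewrite (reindex_onto (fun B => B :|: a) (fun B => B :\: a)) /=; last first.
  move=> B /andP[_ aB]; rewrite setUC; apply/setP=> x; rewrite !inE.
  by have := subsetP aB x; case: (x \in a) => //= ->.
apply/eqP; rewrite addr_eq0; apply/eqP; rewrite -sumrN.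
have aFF := atom_algebra aF.
(* First the two index sets are matched, then the terms are shown to be opposite. *)
apply: eq_big => [B|B].
  rewrite subsetUr andbT setDUl setDv setU0 -[B :\: a == B](sameP setDidPl eqP).
  rewrite disjoint_sym.
  (* If [a] meets a member [B] of [F], it lies inside [B], so [B] is in neither index set. *)
  have [aB|aB] := boolP [disjoint a & B]; last first.
    rewrite andbF; apply/esym/negP=> /andP[/andP[BF _]].
    by rewrite atom_nsub_disjoint // (negbTE aB).
  have -> : (B :|: a \in F) = (B \in F).
    apply/idP/idP=> [BaF|BF]; last exact: (algebra_setU algF).
    have -> : B = (B :|: a) :\: a.
      by rewrite setDUl setDv setU0 (setDidPl _) // disjoint_sym.
    exact: algebra_setD.
  have [BF|//] /= := boolP (B \in F).
  rewrite atom_nsub_disjoint // aB !andbT subUset aA andbT; congr (_ && _).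
  apply/idP/idP=> [CBa|CB]; last exact: subset_trans CB (subsetUl _ _).
  rewrite -(setIidPl CBa) setIUr [C :&: a]setIC (disjoint_setI0 aC) setU0.
  exact: subsetIr.
rewrite setDUl setDv setU0 => /andP[_ /eqP/setDidPl Ba].
(* As [a] avoids [C], removing [C] from [B :|: a] leaves [a] whole: exactly one atom more than in
   [B :\: C]. *)
rewrite setDUl (setDidPl aC) natomsU1 ?exprS ?mulN1r //.
by apply: disjointWr (subsetDl _ _) _; rewrite disjoint_sym.
Qed.

(** After exchanging the sums, the coefficient of [P C] is the alternating sum over the interval
    from [C] to [A], which vanishes unless [C] is [A]. *)
Lemma sum_mass (P : {set Omega} -> R) A : A \in F ->
  \sum_(B in F | B \subset A) mass F P B = P A.
Proof.
move=> AF; rewrite /mass.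
rewrite (exchange_big_dep (fun C => (C \in F) && (C \subset A))) /=; last first.
  by move=> B C /andP[_ BA] /andP[-> CB]; apply: subset_trans CB BA.
under eq_bigr => C /andP[CF CA].
  rewrite -mulr_suml.
  rewrite (eq_bigl (fun B => (B \in F) && ((C \subset B) && (B \subset A))));
    last by move=> B; rewrite CF /= -andbA [(B \subset A) && _]andbC.
  rewrite alternating_sum_interval //.
  over.
rewrite (bigD1 A) /= ?AF ?subxx // eqxx mul1r big1 ?addr0 // => C.
by case/andP=> _ /negbTE->; rewrite mul0r.
Qed.

Lemma sum_mass_function (P m : {set Omega} -> R) A :
  mass_function F P m -> A \in F -> \sum_(B in F | B \subset A) m B = P A.
Proof.
move=> mP AF; rewrite -sum_mass //; apply: eq_bigr => B /andP[BF _].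
exact: mP.
Qed.

End SetAlgebra.

Theorem theorem27 (R : realFieldType) (Omega : finType)
    (F : {set {set Omega}}) (E : {set Omega})
    (P m PI : {set Omega} -> R) (f : {set Omega} -> {set Omega} -> R)
    (Omega_gt0 : (0 < #|Omega|)%N) (algF : set_algebra F) (EF : E \in F)
    (beliefP : belief_function F P) (massP : mass_function F P m)
    (PE_gt0 : 0 < P E)
    (weightsf : imaging_weights F E f)
    (imagingPI : generalized_imaging F f m PI) :
  forall A : {set Omega}, A \in F ->
    (strictly_constricts P PI A <->
     (\sum_(B in F | B \subset A) (\sum_(X in F) f B X * m X - m B) > 0 /\
      \sum_(B in F | B \subset ~: A) (\sum_(X in F) f B X * m X - m B) > 0)).
Proof.
case: imagingPI => _ massPI A AF.
have gap C : C \in F ->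
    \sum_(B in F | B \subset C) (\sum_(X in F) f B X * m X - m B) = PI C - P C.
  (* Inversion is applied to [m] and to [imaging_mass F f m]; the latter unfolds to the inner sum
     over [X]. *)
  by move=> CF; rewrite sumrB (sum_mass_function algF massP CF)
    -(sum_mass_function algF massPI CF).
rewrite !gap //; last exact: algebra_setC.
by rewrite /strictly_constricts /upper !subr_gt0 ltrD2l ltrN2.
Qed.
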